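(* Let $p$ be a prime, let $l,n\in\mathbb{N}$, $r,s,t\in\mathbb{Z}$ with $0\leqslant s,t<p$. Then for every integer $\alpha\geqslant 2$, $$\frac1{\lfloor n/p^{\alpha-1}\rfloor!}\sum_{k\equiv r\ (\mathrm{mod}\ p^{\alpha})}\binom{pn+s}{pk+t}(-1)^{pk}\Big(\frac{k-r}{p^{\alpha-1}}\Big)^l\equiv\frac1{\lfloor n/p^{\alpha-1}\rfloor!}\sum_{k\equiv r\ (\mathrm{mod}\ p^{\alpha})}\binom nk\binom st(-1)^k\Big(\frac{k-r}{p^{\alpha-1}}\Big)^l\pmod p.$$
   Context: Sums run over all integers $k$ in the indicated residue class; $\binom{N}{j}=0$ unless $0\le j\le N$. For rationals $u,v$, $u\equiv v\pmod p$ means $\operatorname{ord}_p(u-v)\ge 1$, where $\operatorname{ord}_p$ is the $p$-adic order. *)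

(* Defs.v *)
From HB Require Import structures.
From mathcomp Require Import all_boot all_order all_algebra.
Set Implicit Arguments. Unset Strict Implicit. Unset Printing Implicit Defensive.
Import Order.TTheory GRing.Theory Num.Theory.
Local Open Scope ring_scope.

Definition binZ (N j : int) : rat :=
  if (0 <= j) && (j <= N) then ('C(`|N|%N, `|j|%N))%:R else 0.

(* p-adic order of a nonzero rational (0 is treated separately below). *)
Definition padic_ord (p : nat) (x : rat) : int :=
  (logn p `|numq x|%N)%:Z - (logn p `|denq x|%N)%:Z.

(* u == v (mod p) for rationals: ord_p(u - v) >= 1 (ord_p 0 = +oo). *)
Definition rat_congr (p : nat) (u v : rat) : Prop :=
  u - v = 0 \/ 1 <= padic_ord p (u - v).

(* Sum of F k over the integers k in the window [-B, B] with
   k == r (mod m).  Used with a window containing the whole support. *)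
Definition resid_sum (B m : nat) (r : int) (F : int -> rat) : rat :=
  \sum_(i < (2 * B).+1 | ((i%:Z - B%:Z) == r %[mod m%:Z])%Z) F (i%:Z - B%:Z).

(* Main.v *)
Require Import Defs.
From HB Require Import structures.
From mathcomp Require Import all_boot all_order all_algebra.
From mathcomp Require Import zify ring.
Import Order.TTheory GRing.Theory Num.Theory.
Local Open Scope ring_scope.

(** The sums in question are values of linear functionals on Z[X]: the sum of
    [P_i w_i] over i, with weight [w_i = ((i - r) / p^a)^l] on the class
    [i = r mod p^(a+1)] and 0 elsewhere. Expanding
    [(1-X)^(pn+s) = ((1 - X^p) + p (1-X) g)^n (1-X)^s] by the binomial theorem,
    and noting that the weight at level a+1 restricted to a class modulo p is
    either 0 or a weight at level a, one obtains
      (level a+1 of (1-X)^(pn+s)) =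
        sum over i of C(n,i) p^i (combination of level a of (1-X)^(n-i)).
    By induction on a, the level-a sum of (1-X)^n is divisible by the p-part of
    [floor(n/p^a)!]; the case a = 0, l = 0 is Fleck's congruence, and l is raised
    by the operator X d/dX. In the expansion the term i = 0 is exactly the
    right-hand side of the theorem, and the terms i > 0 gain a further factor p
    because ord_p(i!) <= i - 1. *)

(** * Valuations of factorials and binomial coefficients *)

Lemma logn_factE (p n : nat) : prime p ->
  logn p n`! = (n %/ p + logn p (n %/ p)`!)%N.
Proof.
move=> p_pr; case: n => [|n]; first by rewrite div0n.
have lt_div : (n.+1 %/ p < n.+1)%N by rewrite ltn_Pdiv // prime_gt1.
rewrite !logn_fact // big_nat_recl // expn1; congr addn.
rewrite big_add1 /= [in RHS]big_add1 /=.
rewrite (@big_cat_nat _ _ _ (n.+1 %/ p)) //=.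
rewrite [X in (_ + X)%N]big1_seq ?addn0; last first.
  move=> k /andP[_]; rewrite mem_index_iota => /andP[le_k _].
  rewrite expnS divnMA divn_small //; apply: leq_ltn_trans le_k _.
  by apply: ltn_trans (ltnSn k) _; rewrite ltn_expl ?prime_gt1.
by apply: eq_bigr => k _; rewrite expnS divnMA.
Qed.

(** By Legendre, (p-1) ord_p(n!) is n minus its base-p digit sum, which is positive for n > 0. *)
Lemma logn_fact_bound (p n : nat) : prime p -> (0 < n)%N ->
  (p.-1 * logn p n`! < n)%N.
Proof.
move=> p_pr; elim/ltn_ind: n => n IH n_gt0; have p_gt1 := prime_gt1 p_pr.
rewrite logn_factE //; have [lt_np|le_pn] := ltnP n p.
  by rewrite divn_small // logn1 muln0.
have d_gt0 : (0 < n %/ p)%N by rewrite divn_gt0 // prime_gt0.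
have := IH _ (ltn_Pdiv p_gt1 n_gt0) d_gt0; have := leq_divM n p.
case: p p_pr p_gt1 {IH le_pn d_gt0} => // p _ _ /=.
by rewrite mulnDr mulnS; lia.
Qed.

(* ord_p(n!) - ord_p(floor(n/p^a)!) is the sum of the floors of n/p^k for
   1 <= k <= a, hence nondecreasing in n. *)
Lemma logn_fact_div (p a m n : nat) : prime p -> (m <= n)%N ->
  (logn p (n %/ p ^ a)`! + logn p m`! <= logn p n`! + logn p (m %/ p ^ a)`!)%N.
Proof.
move=> p_pr le_mn; elim: a => [|a IH]; first by rewrite !divn1 addnC.
rewrite expnSr !divnMA; have := leq_div2r p (leq_div2r (p ^ a) le_mn).
move: IH; rewrite (@logn_factE p (n %/ _)) // (@logn_factE p (m %/ p ^ a)) //.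
lia.
Qed.

(** Follows from C(n,i) i! (n-i)! = n!, the monotonicity above at n - i, and ord_p(i!) <= i - 1 for
    i > 0; the summand [(0 < i)] records the extra factor p. *)
Lemma logn_bin_fact_div (p a i n : nat) : prime p -> (i <= n)%N ->
  (logn p (n %/ p ^ a)`! + (0 < i) <=
    logn p 'C(n, i) + i + logn p ((n - i) %/ p ^ a)`!)%N.
Proof.
move=> p_pr le_in.
have := @logn_fact_div p a (n - i) n p_pr (leq_subr _ _).
have := congr1 (logn p) (bin_fact le_in).
rewrite !lognM ?muln_gt0 ?fact_gt0 ?bin_gt0 //.
have: (logn p i`! + (0 < i) <= i)%N.
  case: i {le_in} => [|i]; first by rewrite logn1.
  have := @logn_fact_bound p i.+1 p_pr isT.
  by case: p p_pr (prime_gt1 p_pr) => [|[|p]] //= _ _; nia.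
lia.
Qed.

(** * Weighted coefficient sums as linear functionals on Z[X] *)

Definition wsum (w : nat -> int) (P : {poly int}) : int :=
  \sum_(i < size P) P`_i * w i.

Lemma wsumE (w : nat -> int) (P : {poly int}) (m : nat) : (size P <= m)%N ->
  wsum w P = \sum_(i < m) P`_i * w i.
Proof.
move=> le_Pm; rewrite /wsum (big_ord_widen _ (fun i => P`_i * w i) le_Pm).
rewrite big_mkcond; apply: eq_bigr => i _; case: ltnP => // le_Pi.
by rewrite nth_default ?mul0r.
Qed.

Lemma wsumD (w : nat -> int) : {morph wsum w : P Q / P + Q}.
Proof.
move=> P Q; set m := maxn (size P) (size Q).
rewrite !(@wsumE _ _ m) ?size_polyD ?leq_maxl ?leq_maxr // -big_split /=.
by apply: eq_bigr => i _; rewrite coefD mulrDl.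
Qed.

Lemma wsumZ (w : nat -> int) (c : int) (P : {poly int}) :
  wsum w (c *: P) = c * wsum w P.
Proof.
rewrite !(@wsumE _ _ (size P)) ?size_scale_leq // mulr_sumr.
by apply: eq_bigr => i _; rewrite coefZ mulrA.
Qed.

Lemma wsumB (w : nat -> int) (P Q : {poly int}) :
  wsum w (P - Q) = wsum w P - wsum w Q.
Proof. by rewrite wsumD -scaleN1r wsumZ mulN1r. Qed.

Lemma wsum0 (w : nat -> int) : wsum w 0 = 0.
Proof. by rewrite /wsum size_poly0 big_ord0. Qed.

Lemma wsum_sum (w : nat -> int) (I : Type) (s : seq I) (F : I -> {poly int}) :
  wsum w (\sum_(i <- s) F i) = \sum_(i <- s) wsum w (F i).
Proof. exact: (big_morph _ (wsumD w) (wsum0 w)). Qed.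

Lemma wsumXn (w : nat -> int) (k : nat) : wsum w 'X^k = w k.
Proof.
rewrite /wsum size_polyXn big_ord_recr /= coefXn eqxx mul1r big1 ?add0r // => i _.
by rewrite coefXn ltn_eqF ?mul0r.
Qed.

Lemma eq_wsum (w w' : nat -> int) (P : {poly int}) :
  w =1 w' -> wsum w P = wsum w' P.
Proof. by move=> eq_w; apply: eq_bigr => i _; rewrite eq_w. Qed.

(** Writing exponents as p i + j gives one sum over Q for each monomial X^j of h. *)
Lemma wsum_compXn (w : nat -> int) (p : nat) (Q h : {poly int}) :
  wsum w ((Q \Po 'X^p) * h) =
    wsum (fun j => wsum (fun i => w (p * i + j)%N) Q) h.
Proof.
rewrite -{1}[h]coefK poly_def mulr_sumr wsum_sum.
apply: eq_bigr => j _; rewrite -scalerAr wsumZ; congr (_ * _).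
rewrite comp_polyE mulr_suml wsum_sum; apply: eq_bigr => i _.
by rewrite -scalerAl wsumZ -exprM -exprD wsumXn.
Qed.

Lemma wsumMXn (w : nat -> int) (j : nat) (P : {poly int}) :
  wsum w (P * 'X^j) = wsum (fun i => w (i + j)%N) P.
Proof.
rewrite -[in LHS](comp_polyXr P) -[X in _ \Po X]expr1 wsum_compXn.
by rewrite wsumXn; apply: eq_wsum => i; rewrite mul1n.
Qed.

(** The factor i comes from X d/dX; dropping the X shifts the weight by one. *)
Lemma wsum_deriv (w : nat -> int) (P : {poly int}) :
  wsum (fun i => i%:Z * w i) P = wsum (fun i => w i.+1) P^`().
Proof.
rewrite (@wsumE _ P (size P).+1) // big_ord_recl mul0r mulr0 add0r.
rewrite (@wsumE _ _ (size P)); last first.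
  by apply/leq_sizeP => j le_j; rewrite coef_deriv nth_default ?mul0rn ?leqW.
by apply: eq_bigr => i _; rewrite lift0 coef_deriv -mulr_natr natz; ring.
Qed.

(** * Powers of 1 - X *)

Lemma coef_expr1BX (n j : nat) :
  ((1 - 'X) ^+ n : {poly int})`_j = (-1) ^+ j * 'C(n, j)%:Z.
Proof.
elim: n j => [|n IH] [|j]; rewrite ?bin0 ?exprS ?mulrBl ?mul1r ?coefB ?coefXM /=.
- by rewrite expr0 coef1.
- by rewrite expr0 coef1 mulr0.
- by rewrite IH subr0 bin0.
- by rewrite !IH binS PoszD exprS mulN1r !mulNr mulrDr opprD.
Qed.

(** The quotient of (1 - X)^p - (1 - X^p) by p vanishes at 1, which yields the further factor 1 -
    X. *)
Lemma expr1BX_prime (p : nat) : prime p -> exists g : {poly int},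
  (1 - 'X) ^+ p = 1 - 'X^p + p%:R * ((1 - 'X) * g).
Proof.
move=> p_pr; have p_gt0 := prime_gt0 p_pr.
have [g0 Eg0] : exists g : {poly int}, (- 'X) ^+ p = - 'X^p + p%:R * g.
  (* For p = 2 the sign is repaired by X^2 = -X^2 + 2 X^2. *)
  case: (even_prime p_pr) => [->|p_odd].
    by exists 'X^2; rewrite sqrrN; ring.
  by exists 0; rewrite exprNn -signr_odd p_odd expr1 mulN1r mulr0 addr0.
have [g Eg] : exists g : {poly int}, (1 - 'X) ^+ p = 1 - 'X^p + p%:R * g.
  exists (\sum_(i < p.-1) ((- 'X) ^+ i.+1) *+ ('C(p, i.+1) %/ p) + g0).
  rewrite exprDn -[in LHS](prednK p_gt0) big_ord_recl big_ord_recr /=.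
  rewrite /bump /= add1n prednK // bin0 subnn subn0 !binn !expr1n !mulr1n mul1r.
  rewrite Eg0 [p%:R * (_ + _)]mulrDr mulr_sumr expr0.
  set S1 := \sum_(i < _) _; set S2 := \sum_(i < _) _.
  suff -> : S1 = S2 by ring.
  apply: eq_bigr => i _; rewrite expr1n mul1r add1n mulr_natl -mulrnA.
  by rewrite divnK // prime_dvd_bin //= -ltn_predRL.
have : root g 1.
  have := congr1 (fun P => P.[1]) Eg; rewrite !hornerE subrr !expr1n subrr.
  rewrite expr0n /= gtn_eqF // add0r hornerMn hornerC => /esym/eqP.
  by rewrite mulf_eq0 pnatr_eq0 gtn_eqF.
case/factor_theorem => q Eq; exists (- q); rewrite Eg Eq; congr (_ + _ * _).
by ring.
Qed.

(* Fleck: modulo 1 - X^p, which every p-periodic functional kills, (1-X)^p is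
   divisible by p (1-X). *)
Lemma wsum_periodic_dvd (p j : nat) (w : nat -> int) (h : {poly int}) :
  prime p -> (forall i, w (i + p)%N = w i) ->
  (p%:Z ^+ j %| wsum w ((1 - 'X) ^+ (1 + p.-1 * j) * h))%Z.
Proof.
move=> p_pr w_per; have [g Eg] := expr1BX_prime p p_pr.
elim: j h => [|j IH] h; first by rewrite expr0 dvd1z.
(* Expanding one (1 - X)^p returns a factor 1 - X along with p, so each power of p costs only p - 1
   factors. *)
have -> : (1 - 'X) ^+ (1 + p.-1 * j.+1) * h =
    ((1 - 'X) ^+ (p.-1 * j) * h - (1 - 'X) ^+ (p.-1 * j) * h * 'X^p) +
    p%:Z *: ((1 - 'X) ^+ (1 + p.-1 * j) * (g * h)).
  rewrite mulnS addnA add1n (prednK (prime_gt0 p_pr)) !exprD Eg.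
  by rewrite -mul_polyC -[p%:Z]natz rmorph_nat expr1; ring.
rewrite wsumD wsumB wsumMXn (eq_wsum _ w) // subrr add0r wsumZ exprS.
exact: dvdz_mul.
Qed.

(** * Weights supported on a residue class *)

(** The class is modulo p^(a+1) but the division is by p^a, so the integer quotient is exact on the
    support. *)
Definition weight (p a l : nat) (r : int) (i : nat) : int :=
  if (p%:Z ^+ a.+1 %| i%:Z - r)%Z
  then ((i%:Z - r) %/ p%:Z ^+ a)%Z ^+ l else 0.

Lemma weight_shift (p a l : nat) (r : int) (i j : nat) :
  weight p a l r (i + j)%N = weight p a l (r - j%:Z) i.
Proof.
rewrite /weight PoszD.
by have -> : i%:Z + j%:Z - r = i%:Z - (r - j%:Z) by ring.
Qed.

Lemma weight0E (p l : nat) (r : int) (i : nat) :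
  weight p 0 l r i = (if (p%:Z %| i%:Z - r)%Z then (i%:Z - r) ^+ l else 0).
Proof. by rewrite /weight expr0 expr1 divz1. Qed.

(** p i + j can lie in the class of r only if p divides r - j; cancelling p then lowers the level by
    one. *)
Lemma weight_lift (p a l : nat) (r : int) (i j : nat) : (0 < p)%N ->
  weight p a.+1 l r (p * i + j)%N =
    (if (p%:Z %| r - j%:Z)%Z then weight p a l ((r - j%:Z) %/ p%:Z)%Z i else 0).
Proof.
move=> p_gt0; have p_neq0 : p%:Z != 0 by rewrite eqz_nat -lt0n.
have -> : weight p a.+1 l r (p * i + j)%N =
          weight p a.+1 l (r - j%:Z) (p * i)%N by apply: weight_shift.
set u := r - _; case: ifP => [/dvdzP[v ->]|u_ndvd].
  rewrite mulzK // /weight PoszM.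
  have -> : p%:Z * i%:Z - v * p%:Z = p%:Z * (i%:Z - v) by ring.
  by rewrite !(exprS _ a.+1) dvdz_mul2l // [in X in (_ %/ X)%Z]exprS divzMpl.
rewrite /weight ifF //; apply: contraFF u_ndvd => /(dvdz_trans _) dvd_u.
have: (p%:Z %| (p * i)%N%:Z - u)%Z by apply: dvd_u; rewrite exprS dvdz_mulr.
by rewrite PoszM rpredBl // dvdz_mulr.
Qed.

(** * Divisibility of the weighted sums *)

Lemma wsum_weight0_dvd (p l n : nat) (r : int) : prime p ->
  (p%:Z ^+ logn p n`! %| wsum (weight p 0 l r) ((1 - 'X) ^+ n))%Z.
Proof.
move=> p_pr; elim: l n r => [|l IH] n r.
  have [->|n_gt0] := posnP n; first by rewrite logn1 dvd1z.
  (* For l = 0 the weight is p-periodic, and the surplus power of 1 - X serves as the cofactor [h]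
     in Fleck's congruence. *)
  have := logn_fact_bound p n p_pr n_gt0; set e := logn p n`! => /subnKC <-.
  rewrite -add1n exprD; apply: wsum_periodic_dvd => // i.
  by rewrite !weight0E !expr0 PoszD addrAC rpredDr ?dvdzz.
(* On the class, (i - r)^(l+1) = i (i - r)^l - r (i - r)^l. *)
have -> : wsum (weight p 0 l.+1 r) ((1 - 'X) ^+ n) =
    wsum (fun i => i%:Z * weight p 0 l r i) ((1 - 'X) ^+ n)
    - r * wsum (weight p 0 l r) ((1 - 'X) ^+ n).
  rewrite /wsum mulr_sumr -sumrB; apply: eq_bigr => i _; rewrite !weight0E.
  by case: ifP => _; rewrite ?exprS; ring.
apply: rpredB; last by apply: dvdz_mull.
rewrite wsum_deriv; case: n => [|n]; first by rewrite logn1 dvd1z.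
(* The derivative costs one power of 1 - X but brings out n + 1, matching (n+1)! = (n+1) n!. *)
have -> : ((1 - 'X) ^+ n.+1)^`() = - n.+1%:Z *: (1 - 'X) ^+ n :> {poly int}.
  rewrite deriv_exp derivB derivC derivX sub0r /= mulN1r.
  by rewrite -[n.+1%:Z]natz scaleNr scaler_nat mulNrn.
rewrite wsumZ factS lognM ?fact_gt0 // exprD mulNr rpredN dvdz_mul //.
  by rewrite dvdzE abszX pfactor_dvdnn.
rewrite (eq_wsum _ (weight p 0 l (r - 1))) // => i.
by rewrite -weight_shift addn1.
Qed.

Lemma expr1BX_expand (p n s : nat) (g : {poly int}) :
  (1 - 'X) ^+ p = 1 - 'X^p + p%:R * ((1 - 'X) * g) ->
  (1 - 'X) ^+ (p * n + s) = \sum_(i < n.+1) ('C(n, i) * p ^ i)%N%:Z *: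
    (((1 - 'X) ^+ (n - i) \Po 'X^p) * (((1 - 'X) * g) ^+ i * (1 - 'X) ^+ s)).
Proof.
move=> Eg; rewrite exprD exprM Eg exprDn mulr_suml; apply: eq_bigr => i _.
rewrite rmorphXn /= rmorphB /= comp_polyX rmorph1.
rewrite -mul_polyC -[_%:Z]natz rmorph_nat natrM natrX exprMn -mulr_natl.
by ring.
Qed.

(** Each monomial X^j of h turns the level a+1 weight into zero or a level a weight, to which the
    assumed divisibility applies; C(n,i) p^i supplies the rest. *)
Lemma wsum_term_dvd (p a l n i : nat) (r : int) (h : {poly int}) :
    prime p -> (i <= n)%N ->
    (forall r', p%:Z ^+ logn p ((n - i) %/ p ^ a)`! %|
                wsum (weight p a l r') ((1 - 'X) ^+ (n - i)))%Z ->
  (p%:Z ^+ (logn p (n %/ p ^ a)`! + (0 < i)%N) %|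
    ('C(n, i) * p ^ i)%N%:Z *
    wsum (weight p a.+1 l r) (((1 - 'X) ^+ (n - i) \Po 'X^p) * h))%Z.
Proof.
move=> p_pr le_in IH.
apply: (dvdz_trans (dvdz_exp2l _ (logn_bin_fact_div p a i n p_pr le_in))).
rewrite exprD dvdz_mul //.
  by rewrite exprD PoszM dvdz_mul // dvdzE abszX // pfactor_dvdnn.
rewrite wsum_compXn; apply: rpred_sum => j _; apply: dvdz_mull.
pose v := if (p%:Z %| r - j%:Z)%Z
          then weight p a l ((r - j%:Z) %/ p%:Z)%Z else fun=> 0.
rewrite (eq_wsum _ v) => [|k]; last first.
  by rewrite weight_lift ?prime_gt0 // /v; case: ifP.
rewrite /v; case: ifP => _; first exact: IH.
by rewrite /wsum big1 ?dvdz0 // => k _; rewrite mulr0.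
Qed.

Lemma wsum_weight_dvd (p a l n : nat) (r : int) : prime p ->
  (p%:Z ^+ logn p (n %/ p ^ a)`! %| wsum (weight p a l r) ((1 - 'X) ^+ n))%Z.
Proof.
move=> p_pr; have [g Eg] := expr1BX_prime p p_pr.
elim: a n r => [|a IH] n r; first by rewrite divn1 wsum_weight0_dvd.
(* With n = p n' + s, floor(n/p^(a+1)) = floor(n'/p^a), so the induction runs on n'. *)
rewrite expnS divnMA.
rewrite [in wsum _ _](divn_eq n p) [(_ * p)%N]mulnC (expr1BX_expand _ _ _ _ Eg).
rewrite wsum_sum; apply: rpred_sum => i _; rewrite wsumZ.
apply: dvdz_trans (wsum_term_dvd _ _ _ _ _ _ _ p_pr _ _) => //.
- by rewrite dvdz_exp2l // leq_addr.
- by rewrite -ltnS.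
Qed.

(** * Comparison of consecutive levels *)

Lemma weight_lift_residue (p a l i j t : nat) (r : int) :
    (j < p)%N -> (t < p)%N ->
  weight p a.+1 l (p%:Z * r + t%:Z) (p * i + j)%N =
    (if j == t then weight p a l r i else 0).
Proof.
move=> lt_jp lt_tp; have p_gt0 : (0 < p)%N by apply: leq_ltn_trans lt_tp.
rewrite weight_lift // -addrA rpredDl ?dvdz_mulr //.
have [->|ne_jt] := eqVneq j t.
  by rewrite subrr dvdz0 addr0 mulKz // eqz_nat -lt0n.
rewrite ifF //; apply/negP; rewrite dvdzE /= => dvd_tj.
have tj_gt0 : (0 < `|t%:Z - j%:Z|)%N by lia.
by have := dvdn_leq tj_gt0 dvd_tj; lia.
Qed.

Lemma wsum_weight_lucas_dvd (p a l n s t : nat) (r : int) : prime p ->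
    (s < p)%N -> (t < p)%N ->
  (p%:Z ^+ (logn p (n %/ p ^ a)`!).+1 %|
    wsum (weight p a.+1 l (p%:Z * r + t%:Z)) ((1 - 'X) ^+ (p * n + s))
    - (-1) ^+ t * 'C(s, t)%:Z * wsum (weight p a l r) ((1 - 'X) ^+ n))%Z.
Proof.
move=> p_pr lt_sp lt_tp; have [g Eg] := expr1BX_prime p p_pr.
rewrite (expr1BX_expand _ _ _ _ Eg) big_ord_recl wsumD subn0 bin0 mul1n expn0.
rewrite expr0 mul1r scale1r wsum_compXn.
(* Since s < p, the cofactor (1 - X)^s has only exponents below p, so the class of t picks out the
   single monomial X^t. *)
have le_sp : (size ((1 - 'X) ^+ s : {poly int}) <= p)%N.
  apply/leq_sizeP => j le_pj.
  by rewrite coef_expr1BX bin_small ?mulr0 // (leq_trans lt_sp).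
rewrite (wsumE _ _ _ le_sp) (bigD1 (Ordinal lt_tp)) //= coef_expr1BX.
rewrite (eq_wsum _ (weight p a l r)) => [|i]; last first.
  by rewrite weight_lift_residue ?eqxx.
rewrite [\sum_(j < p | _) _]big1 => [|j ne_jt]; last first.
  rewrite [X in _ * X]big1 ?mulr0 // => i _.
  by rewrite weight_lift_residue // ifN ?mulr0.
(* The first term cancels exactly; every other index [bump 0 i] is positive and gains the extra
   p. *)
rewrite addr0 addrAC subrr add0r wsum_sum; apply: rpred_sum => i _; rewrite wsumZ.
rewrite -(addn1 (logn _ _)).
apply: (wsum_term_dvd _ _ _ _ (bump 0 i)) => // r'; exact: wsum_weight_dvd.
Qed.

(** * Return to rational sums *)

Lemma sum_ord_mul (V : nmodType) (p m : nat) (F : nat -> V) :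
  \sum_(i < p * m) F i = \sum_(k < m) \sum_(j < p) F (p * k + j)%N.
Proof.
elim: m => [|m IH]; first by rewrite muln0 !big_ord0.
by rewrite mulnSr big_split_ord IH big_ord_recr.
Qed.

Lemma resid_sum_nat (B m : nat) (r : int) (F : int -> rat) :
    (forall k : int, k < 0 -> F k = 0) ->
  resid_sum B m r F = \sum_(i < B.+1 | (i%:Z == r %[mod m%:Z])%Z) F i%:Z.
Proof.
move=> F0; rewrite /resid_sum big_mkcond [RHS]big_mkcond.
have -> : (2 * B).+1 = (B + B.+1)%N by lia.
rewrite big_split_ord /= big1 ?add0r => [|i _]; last first.
  by rewrite F0 ?if_same // subr_lt0 ltz_nat.
by apply: eq_bigr => i _; rewrite PoszD addrAC subrr add0r.
Qed.

Lemma weight_ratE (p a l : nat) (r : int) (i : nat) : (0 < p)%N ->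
  (if (i%:Z == r %[mod (p ^ a.+1)%N%:Z])%Z
   then ((i%:Z - r)%:~R / (p ^ a)%N%:R) ^+ l else 0) =
  (weight p a l r i)%:~R :> rat.
Proof.
move=> p_gt0; have p_neq0 : p%:Z != 0 by rewrite eqz_nat -lt0n.
rewrite eqz_mod_dvd /weight -[(p ^ a.+1)%N%:Z]natz natrX natz.
case: ifP => [/dvdzP[v ->]|//].
rewrite exprS mulrA mulzK ?expf_neq0 // [RHS]rmorphXn /=; congr (_ ^+ l).
rewrite rmorphM /= natrX rmorphXn /= mulfK // expf_neq0 //.
by rewrite pnatr_eq0 -lt0n.
Qed.

Lemma size_expr1BX_leq (n : nat) : (size ((1 - 'X) ^+ n : {poly int}) <= n.+1)%N.
Proof. by apply/leq_sizeP => j lt_nj; rewrite coef_expr1BX bin_small ?mulr0. Qed.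

Lemma rat_congr_div (p M : nat) (u v : int) : prime p -> (0 < M)%N ->
    (p%:Z ^+ (logn p M).+1 %| u - v)%Z ->
  rat_congr p (M%:R^-1 * u%:~R) (M%:R^-1 * v%:~R).
Proof.
move=> p_pr M_gt0 dvd_uv; rewrite /rat_congr -mulrBr -rmorphB /=.
move: dvd_uv; set D := u - v; have [->|D_neq0] := eqVneq D 0.
  by left; rewrite mulr0.
move=> dvd_D; right; set x := _ * _.
have M_neq0 : M%:R != 0 :> rat by rewrite pnatr_eq0 -lt0n.
have x_neq0 : x != 0 by rewrite mulf_neq0 ?invr_neq0 ?intr_eq0.
(* Clearing denominators in x = D/M gives ord_p(x) = ord_p(D) - ord_p(M) without reducing the
   fraction. *)
have E : (M * `|numq x| = `|D| * `|denq x|)%N.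
  rewrite -[M]/(`|M%:Z|%N) -!abszM; congr absz; apply: (@intr_inj rat).
  rewrite !rmorphM /= -[(numq x)%:~R](divfK (_ : (denq x)%:~R != 0)).
    by rewrite divq_num_den /x mulrA mulrA mulfV // mul1r.
  by rewrite intr_eq0 denq_neq0.
have := congr1 (logn p) E.
rewrite !lognM ?absz_gt0 ?numq_eq0 ?denq_neq0 //.
have : ((logn p M).+1 <= logn p `|D|)%N.
  rewrite -pfactor_dvdn ?absz_gt0 //; move: dvd_D.
  by rewrite dvdzE abszX.
by rewrite /padic_ord; lia.
Qed.

Theorem theorem1p6 (p : nat) (l n : nat) (r s t : int) (alpha : nat) :
  prime p ->
  0 <= s < p%:Z -> 0 <= t < p%:Z ->
  (2 <= alpha)%N ->
  let c : rat := (((n %/ p ^ alpha.-1)`!)%:R)^-1 in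
  let q : rat := (p ^ alpha.-1)%:R in
  rat_congr p
    (c * resid_sum (p * n + `|s| + `|t|).+1 (p ^ alpha) r
       (fun k => binZ (p%:Z * n%:Z + s) (p%:Z * k + t)
                 * (-1) ^ (p%:Z * k) * (((k - r)%:~R / q) ^+ l)))
    (c * resid_sum (p * n + `|s| + `|t|).+1 (p ^ alpha) r
       (fun k => binZ n%:Z k * binZ s t
                 * (-1) ^ k * (((k - r)%:~R / q) ^+ l))).
Proof.
move=> p_pr; have p_gt0 := prime_gt0 p_pr.
case: s => // s; case: t => // t; rewrite !ltz_nat => /andP[_ lt_sp] /andP[_ lt_tp].
case: alpha => // a _; rewrite !absz_nat /=; set B := (p * n + s + t).+1.
have binZE N j : binZ N%:Z j%:Z = 'C(N, j)%:R.
  by rewrite /binZ /= lez_nat; case: leqP => // /bin_small ->.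
have binZ_neg N (j : int) : j < 0 -> binZ N j = 0.
  by rewrite /binZ ltNge => /negbTE ->.
(* As p k + t - (p r + t) = p (k - r), [W1] at level a+1 weights k just as [W2] does at level a. *)
pose W1 := wsum (weight p a.+1 l (p%:Z * r + t%:Z)) ((1 - 'X) ^+ (p * n + s)).
pose W2 := wsum (weight p a l r) ((1 - 'X) ^+ n).
have -> : resid_sum B (p ^ a.+1) r
    (fun k => binZ n%:Z k * binZ s%:Z t%:Z * (-1) ^ k
              * (((k - r)%:~R / (p ^ a)%:R) ^+ l)) = ('C(s, t)%:Z * W2)%:~R.
  rewrite resid_sum_nat => [|k k_lt0]; last by rewrite binZ_neg // !mul0r.
  rewrite /W2 (@wsumE _ _ B.+1) ?mulr_sumr; last first.
    by rewrite (leq_trans (size_expr1BX_leq _)) // /B; nia.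
  rewrite rmorph_sum big_mkcond; apply: eq_bigr => k _ /=.
  rewrite coef_expr1BX !rmorphM /= -weight_ratE // rmorph_sign !binZE -!pmulrn.
  by case: ifP => _; rewrite ?mulr0 // -exprnP; ring.
(* The prefactor (-1)^t reduces the coefficient sign (-1)^(p k + t) to (-1)^(p k). *)
have -> : resid_sum B (p ^ a.+1) r
    (fun k => binZ (p%:Z * n%:Z + s%:Z) (p%:Z * k + t%:Z) * (-1) ^ (p%:Z * k)
              * (((k - r)%:~R / (p ^ a)%:R) ^+ l)) = ((-1) ^+ t * W1)%:~R.
  rewrite resid_sum_nat => [|k k_lt0]; last first.
    (* As t < p, k < 0 forces p k + t < 0. *)
    by rewrite binZ_neg ?mul0r //; nia.
  (* This length exceeds the degree and splits into blocks of indices p k + j with j < p, where only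
     j = t contributes. *)
  rewrite /W1 (@wsumE _ _ (p * B.+1)%N) ?mulr_sumr; last first.
    by rewrite (leq_trans (size_expr1BX_leq _)) // /B; nia.
  rewrite (@sum_ord_mul _ p B.+1 (fun i => _ * (_`_i * weight p a.+1 l _ i))).
  rewrite rmorph_sum big_mkcond; apply: eq_bigr => k _ /=.
  rewrite (bigD1 (Ordinal lt_tp)) //= big1 ?addr0.
    rewrite weight_lift_residue // eqxx coef_expr1BX !rmorphM /=.
    rewrite -weight_ratE // !rmorph_sign -!PoszM -!PoszD binZE -exprnP -pmulrn.
    case: ifP => _; rewrite ?mulr0 // exprD !mulrA.
    by rewrite [_ * _ * (-1) ^+ t]mulrAC -expr2 sqrr_sign mul1r [_%:R * _]mulrC.
  by move=> j ne_jt; rewrite weight_lift_residue // ifN ?mulr0.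
apply: rat_congr_div; rewrite ?fact_gt0 //.
have -> : (-1) ^+ t * W1 - 'C(s, t)%:Z * W2 =
          (-1) ^+ t * (W1 - (-1) ^+ t * 'C(s, t)%:Z * W2).
  by rewrite mulrBr !mulrA -exprMn mulrNN mulr1 expr1n mul1r.
by rewrite dvdz_mull // wsum_weight_lucas_dvd.
Qed.
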